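(* Let $f:[a,b]\to\mathbb{R}$ be a continuous $\Phi$-monotone function. Then for any even number $n\in\mathbb{N}$, $$f(a)-\frac{n}{2}\Phi\Big(\frac{b-a}{n}\Big)\leq\frac{1}{b-a}\mathcal{S}_{n}(f)\leq f(b)+\frac{n}{2}\Phi\Big(\frac{b-a}{n}\Big).$$
   Context: Let $a<b$ be real numbers. $\mathbb{N}$ denotes the set of positive integers and $\mathbb{R}_+$ the set of nonnegative reals. $\Phi:[0,b-a]\to\mathbb{R}_+$ is an arbitrary function (called the error function). A function $f:[a,b]\to\mathbb{R}$ is $\Phi$-monotone if $f(x)\leq f(y)+\Phi(y-x)$ for all $x,y\in[a,b]$ with $x<y$. For $n\in\mathbb{N}$ put $x_i=a+\frac{(b-a)i}{n}$, $i=0,1,\ldots,n$. For even $n\in\mathbb{N}$, Simpson's rule is $$\mathcal{S}_{n}(f)=\frac{b-a}{3n}\Big[f(x_0)+2\sum_{i=1}^{(n/2)-1}f(x_{2i})+4\sum_{i=1}^{n/2}f(x_{2i-1})+f(x_n)\Big].$$ *)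

(* Defs.v *)
From HB Require Import structures.
From mathcomp Require Import all_boot all_order all_algebra.
From mathcomp Require Import all_classical all_reals all_analysis.
Set Implicit Arguments.
Unset Strict Implicit.
Unset Printing Implicit Defensive.

Import Order.TTheory GRing.Theory Num.Theory.
Import numFieldNormedType.Exports.

Local Open Scope ring_scope.

(* Functions on [a, b] or [0, b - a] are represented by total functions R -> R
   whose values outside of the interval are irrelevant. *)

Definition error_function (R : realType) (a b : R) (Phi : R -> R) : Prop :=
  forall t, t \in `[0, b - a] -> 0 <= Phi t.

Definition Phi_monotone (R : realType) (a b : R) (Phi f : R -> R) : Prop :=
  forall x y, x \in `[a, b] -> y \in `[a, b] -> x < y ->
    f x <= f y + Phi (y - x).

Definition node (R : realType) (a b : R) (n i : nat) : R :=
  a + (b - a) * i%:R / n%:R.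

(* Only meaningful for n even and positive; the first sum is empty if n = 2. *)
Definition simpson (R : realType) (a b : R) (n : nat) (f : R -> R) : R :=
  let x := node a b n in
  (b - a) / (3 * n%:R) *
  (f (x 0%N) + 2 * (\sum_(1 <= i < n./2) f (x (2 * i)%N))
   + 4 * (\sum_(1 <= i < n./2.+1) f (x (2 * i - 1)%N)) + f (x n)).

(* Main.v *)
Require Import Defs.
From HB Require Import structures.
From mathcomp Require Import all_boot all_order all_algebra.
From mathcomp Require Import all_classical all_reals all_analysis.
From mathcomp Require Import ring lra zify.
Import Order.TTheory GRing.Theory Num.Theory.
Import numFieldNormedType.Exports.
Local Open Scope classical_set_scope.
Local Open Scope ring_scope.

(** Put [n = 2 m], [e = Phi ((b - a) / n)] and [g i = f (x_i)].  Consecutive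
    nodes are [(b - a) / n] apart, so [g] satisfies [g i <= g i.+1 + e]: it
    drops by at most [e] at each step.  The Simpson sum is the sum of
    the [m] panels [g (2j) + 4 g (2j+1) + g (2j+2)] ([simpson_panels]), each of
    total weight 6.  Going from [x_0] to [x_i] costs at most [i e], so panel [j]
    is at least
    [6 g 0 - (2j + 4 (2j+1) + (2j+2)) e = 6 g 0 - 6 (2j+1) e].
    As the first [m] odd numbers add up to [m ^ 2], the whole sum is at least
    [6 m g 0 - 6 m^2 e], and dividing by the total weight [3 n = 6 m] leaves an
    error of [m e = n/2 e].  The upper bound is the mirror image, with
    distances measured to [x_n] ([panels_ge], [panels_le]). *)

(** The left-hand side is the bracket of Simpson's rule; interior even nodes
    get their weight 2 from the two panels that share them. *)
Lemma simpson_panels (R : comNzRingType) (g : nat -> R) (m : nat) : (0 < m)%N ->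
  g 0 + 2 * (\sum_(1 <= i < m) g (2 * i)%N)
      + 4 * (\sum_(1 <= i < m.+1) g (2 * i - 1)%N) + g (2 * m)%N =
  \sum_(j < m) (g (2 * j)%N + 4 * g (2 * j).+1 + g (2 * j).+2).
Proof.
case: m => // m _; elim: m => [|m IHm].
  by rewrite big_geq // big_nat1 big_ord1 mulr0 addr0.
rewrite big_ord_recr -IHm /= [in LHS]big_nat_recr // [X in 4 * X]big_nat_recr //=.
have -> : (2 * m.+2 - 1)%N = (2 * m.+1).+1 by lia.
have -> : (2 * m.+2)%N = (2 * m.+1).+2 by lia.
ring.
Qed.

Lemma telescoped_ge (R : realFieldType) (g : nat -> R) (e : R) (N : nat) :
  (forall i, (i < N)%N -> g i <= g i.+1 + e) ->
  forall i, (i <= N)%N -> g 0%N <= g i + i%:R * e.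
Proof.
move=> g_step; elim=> [|i IHi] leiN; first by rewrite mul0r addr0.
have := IHi (ltnW leiN); have := g_step i leiN.
rewrite -natr1; lra.
Qed.

(** The panel that starts at [2m] loses at most [6 (2m+1) e] against [6 g 0],
    which is the increment of [6 m^2 e] from [m] to [m+1]. *)
Lemma panels_ge (R : realFieldType) (g : nat -> R) (e : R) (m : nat) :
  (forall i, (i < 2 * m)%N -> g i <= g i.+1 + e) ->
  6 * m%:R * g 0%N - 6 * m%:R ^+ 2 * e <=
  \sum_(j < m) (g (2 * j)%N + 4 * g (2 * j).+1 + g (2 * j).+2).
Proof.
elim: m => [|m IHm] g_step; first by rewrite big_ord0; lra.
rewrite big_ord_recr /=.
have {}IHm := IHm (fun i (lti : (i < 2 * m)%N) => g_step i ltac:(lia)).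
have d0 := @telescoped_ge _ _ _ _ g_step (2 * m)%N ltac:(lia).
have d1 := @telescoped_ge _ _ _ _ g_step (2 * m).+1 ltac:(lia).
have d2 := @telescoped_ge _ _ _ _ g_step (2 * m).+2 ltac:(lia).
move: d0 d1 d2 IHm; rewrite -!natr1 natrM; nra.
Qed.

(** Here the right endpoint moves with [m]: carrying the previous bound from
    [g (2m)] to [g (2m+2)] costs [12 m e], and the new panel costs [6 e]. *)
Lemma panels_le (R : realFieldType) (g : nat -> R) (e : R) (m : nat) :
  (forall i, (i < 2 * m)%N -> g i <= g i.+1 + e) ->
  \sum_(j < m) (g (2 * j)%N + 4 * g (2 * j).+1 + g (2 * j).+2) <=
  6 * m%:R * g (2 * m)%N + 6 * m%:R ^+ 2 * e.
Proof.
elim: m => [|m IHm] g_step; first by rewrite big_ord0; lra.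
rewrite big_ord_recr /=.
have {}IHm := IHm (fun i (lti : (i < 2 * m)%N) => g_step i ltac:(lia)).
have s0 := g_step (2 * m)%N ltac:(lia).
have s1 := g_step (2 * m).+1 ltac:(lia).
have -> : (2 * m.+1)%N = (2 * m).+2 by lia.
have s01 : g (2 * m)%N <= g (2 * m).+2 + 2 * e by lra.
have := ler_wpM2l (ler0n R m) s01.
move: IHm; rewrite -!natr1; lra.
Qed.

Lemma node_itv (R : realType) (a b : R) (n i : nat) :
  a < b -> (0 < n)%N -> (i <= n)%N -> node a b n i \in `[a, b].
Proof.
move=> ltab n_gt0 lein; rewrite in_itv /= /node -mulrA.
have n_pos : 0 < n%:R :> R by rewrite ltr0n.
have q_ge0 : 0 <= i%:R / n%:R :> R by rewrite divr_ge0 ?ler0n.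
have q_le1 : i%:R / n%:R <= 1 :> R by rewrite ler_pdivrMr // mul1r ler_nat.
by apply/andP; split; nra.
Qed.

Lemma node_succ (R : realType) (a b : R) (n i : nat) :
  node a b n i.+1 - node a b n i = (b - a) / n%:R.
Proof. by rewrite /node -natr1; ring. Qed.

Lemma Phi_monotone_node (R : realType) (a b : R) (Phi f : R -> R) (n i : nat) :
  a < b -> Phi_monotone a b Phi f -> (i < n)%N ->
  f (node a b n i) <= f (node a b n i.+1) + Phi ((b - a) / n%:R).
Proof.
move=> ltab f_mono ltin; have n_gt0 : (0 < n)%N by lia.
rewrite -(node_succ _ a b n i); apply: f_mono; rewrite ?node_itv //; first by lia.
by rewrite -subr_gt0 node_succ divr_gt0 ?subr_gt0 ?ltr0n.
Qed.

Lemma node0 (R : realType) (a b : R) (n : nat) : node a b n 0 = a.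
Proof. by rewrite /node mulr0 mul0r addr0. Qed.

Lemma node_last (R : realType) (a b : R) (n : nat) :
  (0 < n)%N -> node a b n n = b.
Proof.
by move=> n_gt0; rewrite /node mulfK ?pnatr_eq0 -?lt0n // addrC subrK.
Qed.

Theorem theorem2 (R : realType) (a b : R) (Phi f : R -> R)
  (ltab : a < b)
  (Phi_err : error_function a b Phi)
  (f_cont : {within `[a, b], continuous f})
  (f_mono : Phi_monotone a b Phi f)
  (n : nat) (n_gt0 : (0 < n)%N) (n_even : ~~ odd n) :
  f a - n%:R / 2 * Phi ((b - a) / n%:R) <= 1 / (b - a) * simpson a b n f /\
  1 / (b - a) * simpson a b n f <= f b + n%:R / 2 * Phi ((b - a) / n%:R).
Proof.
pose m := n./2; pose g i := f (node a b n i).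
set e := Phi _.
have n2m : n = (2 * m)%N by rewrite /m; lia.
have m_gt0 : (0 < m)%N by lia.
have m_pos : 0 < m%:R :> R by rewrite ltr0n.
have g_step i : (i < 2 * m)%N -> g i <= g i.+1 + e.
  by rewrite -n2m; exact: Phi_monotone_node.
have ga : g 0%N = f a by rewrite /g node0.
have gb : g (2 * m)%N = f b by rewrite /g -n2m node_last.
set W := \sum_(j < m) (g (2 * j)%N + 4 * g (2 * j).+1 + g (2 * j).+2).
have mean_panels : 1 / (b - a) * simpson a b n f = W / (6 * m%:R).
  have -> : simpson a b n f = (b - a) / (3 * n%:R) * W.
    by rewrite /W -simpson_panels // /simpson -n2m.
  have ba_neq0 : b - a != 0 by rewrite subr_eq0 gt_eqF.
  rewrite {1}n2m natrM; field.
  by rewrite ba_neq0 gt_eqF.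
have half_n : n%:R / 2 = m%:R :> R by rewrite {1}n2m natrM; field.
have lo := panels_ge _ g e m g_step.
have up := panels_le _ g e m g_step.
rewrite ga -/W in lo; rewrite gb -/W in up.
rewrite mean_panels half_n; split.
  by rewrite ler_pdivlMr; nra.
by rewrite ler_pdivrMr; nra.
Qed.
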